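(* Let $K$ be an interface element that is a trirectangular tetrahedron or a regular tetrahedron, with faces $F_1,\dots,F_4$ and unit face normals $\mathbf{n}_{F_i}$. Then the space $\mathbf{S}^f_h(K)$ has the degrees of freedom $\int_{F_i}\mathbf{v}_h\cdot\mathbf{n}_{F_i}\,ds$, $i=1,\dots,4$; that is, for any $v_1,\dots,v_4\in\mathbb{R}$ there is a unique $\mathbf{v}_h\in\mathbf{S}^f_h(K)$ with $\int_{F_i}\mathbf{v}_h\cdot\mathbf{n}_{F_i}\,ds=v_i$ for $i=1,\dots,4$.
   Context: A trirectangular tetrahedron is one with three mutually orthogonal faces. An interface element is a tetrahedron $K$ with an affine function $\varphi_h$ on $K$ (the linear interpolant of the interface's level-set function) whose values at the four vertices satisfy $\min\varphi_h\cdot\max\varphi_h<0$. The plane piece $\Gamma_h^K=\{\varphi_h=0\}\cap K$ divides $K$ into two subelements $K_h^+$ and $K_h^-$. $\alpha_h$ equals the positive constant $\alpha^+$ on $K_h^+$ and the positive constant $\alpha^-$ on $K_h^-$. $\mathbf{x}_K$ is a fixed point of $\Gamma_h^K$. $\mathbf{A}_h(K)$ is the space of vector fields $\mathbf{c}$ with $\mathbf{c}^\pm=\mathbf{c}|_{K_h^\pm}$ constant, $\mathbf{c}\in\mathbf{H}(\operatorname{div};K)$ and $\alpha_h\mathbf{c}\in\mathbf{H}(\operatorname{curl};K)$. Equivalently $\mathbf{c}^-=A_K\mathbf{c}^+$, where $A_K=T_K\,\mathrm{diag}(1,\tilde\alpha,\tilde\alpha)\,T_K^\top$, $\tilde\alpha=\alpha^+/\alpha^-$,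 $T_K=[\bar{\mathbf{n}}_K,\bar{\mathbf{t}}_{K,1},\bar{\mathbf{t}}_{K,2}]$ with $\bar{\mathbf{n}}_K$ the unit normal and $\bar{\mathbf{t}}_{K,1},\bar{\mathbf{t}}_{K,2}$ two orthogonal unit tangent vectors to $\Gamma_h^K$. $\mathbf{S}^f_h(K)=\{c(\mathbf{x}-\mathbf{x}_K)+\mathbf{a}_h:\ c\in\mathbb{R},\ \mathbf{a}_h\in\mathbf{A}_h(K)\}$. *)

(* Defs.v *)
From mathcomp Require Import all_boot all_order all_algebra.
From mathcomp Require Import all_classical all_reals all_analysis.

Set Implicit Arguments.
Unset Strict Implicit.
Unset Printing Implicit Defensive.

Import Order.TTheory GRing.Theory Num.Theory.
Import numFieldNormedType.Exports.

Local Open Scope classical_set_scope.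
Local Open Scope ring_scope.

Definition dotv (R : realType) (u v : 'cV[R]_3) : R := (u^T *m v) 0 0.

Definition enorm (R : realType) (u : 'cV[R]_3) : R := Num.sqrt (dotv u u).

(* A tetrahedron is given by its vertices [p 0, ..., p 3]; the face [i] is the
   one opposite to [p i], with vertices [p (lift i k)], k < 3. *)

Definition nondegenerate_tetra (R : realType) (p : 'I_4 -> 'cV[R]_3) : Prop :=
  \det (\matrix_(k < 3, j < 3) (p (lift ord0 j) - p ord0) k 0) != 0.

Definition tetra (R : realType) (p : 'I_4 -> 'cV[R]_3) : set 'cV[R]_3 :=
  [set x | exists l : 'I_4 -> R,
     [/\ forall i, 0 <= l i, \sum_(i < 4) l i = 1
       & x = \sum_(i < 4) l i *: p i]].

(* Either orientation is allowed. *)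
Definition unit_face_normals (R : realType) (p nu : 'I_4 -> 'cV[R]_3) : Prop :=
  forall i, enorm (nu i) = 1 /\
    forall j k, j != i -> k != i -> dotv (nu i) (p j - p k) = 0.

Definition trirectangular_tetra (R : realType) (nu : 'I_4 -> 'cV[R]_3) : Prop :=
  exists i, forall j k, j != i -> k != i -> j != k -> dotv (nu j) (nu k) = 0.

Definition regular_tetra (R : realType) (p : 'I_4 -> 'cV[R]_3) : Prop :=
  exists l : R, forall i j, i != j -> enorm (p i - p j) = l.

Definition affine_fun (R : realType) (g : 'cV[R]_3) (b : R) (x : 'cV[R]_3) : R :=
  dotv g x + b.

Definition interface_element (R : realType) (p : 'I_4 -> 'cV[R]_3)
    (phi : 'cV[R]_3 -> R) : Prop :=
  (\big[Num.min/phi (p ord0)]_(i < 4) phi (p i)) *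
  (\big[Num.max/phi (p ord0)]_(i < 4) phi (p i)) < 0.

Definition interface_piece (R : realType) (p : 'I_4 -> 'cV[R]_3)
    (phi : 'cV[R]_3 -> R) : set 'cV[R]_3 :=
  [set x | tetra p x /\ phi x = 0].

(* The null set [interface_piece p phi] has to go to one side so that the fields
   below, which are classes of functions up to null sets, have a unique
   representative; it is put in the minus part. *)
Definition Kplus (R : realType) (p : 'I_4 -> 'cV[R]_3)
    (phi : 'cV[R]_3 -> R) : set 'cV[R]_3 :=
  [set x | tetra p x /\ 0 < phi x].

Definition Kminus (R : realType) (p : 'I_4 -> 'cV[R]_3)
    (phi : 'cV[R]_3 -> R) : set 'cV[R]_3 :=
  [set x | tetra p x /\ phi x <= 0].

(* [T = [n, t1, t2]] is orthonormal and [n] is normal to the level sets of the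
   affine function with gradient [g]. *)
Definition interface_frame (R : realType) (g : 'cV[R]_3) (T : 'M[R]_3) : Prop :=
  T^T *m T = 1%:M /\ exists s : R, col 0 T = s *: g.

Definition AK (R : realType) (T : 'M[R]_3) (alphap alpham : R) : 'M[R]_3 :=
  T *m diag_mx (\row_(j < 3) if j == 0 then 1 else alphap / alpham) *m T^T.

(* For a field equal to [cp] and [cm] on the two sides of the interface, being
   in H(div) means that its normal component does not jump, and [alpha c] being
   in H(curl) that the tangential components of [alpha c] do not jump. *)
Lemma AK_jump (R : realType) (T : 'M[R]_3) (alphap alpham : R)
    (cp cm : 'cV[R]_3) :
  T^T *m T = 1%:M -> 0 < alpham ->
  cm = AK T alphap alpham *m cp <->
  dotv (col 0 T) cm = dotv (col 0 T) cp /\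
  forall j, j != 0 ->
    alpham * dotv (col j T) cm = alphap * dotv (col j T) cp.
Proof.
move=> TT am0; have amN : alpham != 0 by rewrite gt_eqF.
have dE j (c : 'cV[R]_3) : dotv (col j T) c = (T^T *m c) j 0.
  by rewrite /dotv !mxE; apply: eq_bigr => k _; rewrite !mxE.
set d := \row_(j < 3) if j == 0 then 1 else alphap / alpham.
have -> : cm = AK T alphap alpham *m cp <->
    T^T *m cm = diag_mx d *m (T^T *m cp).
  have TT' := mulmx1C TT; split=> [->|e].
    by rewrite /AK -/d !mulmxA TT mul1mx.
  by rewrite /AK -/d -!mulmxA -e mulmxA TT' mul1mx.
split=> [/matrixP e|[e0 ej]].
  have ec j : dotv (col j T) cm = d 0 j * dotv (col j T) cp.
    by rewrite !dE e mul_diag_mx mxE.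
  split=> [|j j0]; first by rewrite ec mxE eqxx mul1r.
  by rewrite ec mxE (negbTE j0) mulrA mulrCA mulfV // mulr1.
apply/matrixP => j k; rewrite ord1 mul_diag_mx mxE -!dE mxE.
have [->|j0] := eqVneq j 0; first by rewrite mul1r e0.
by apply: (mulfI amN); rewrite ej // mulrA mulrCA mulfV // mulr1.
Qed.

(* Vector fields on [K] are total functions vanishing outside of [K]. *)
Definition Ah (R : realType) (p : 'I_4 -> 'cV[R]_3) (phi : 'cV[R]_3 -> R)
    (A : 'M[R]_3) : set ('cV[R]_3 -> 'cV[R]_3) :=
  [set a | (forall x, ~ tetra p x -> a x = 0) /\
     exists cp cm, [/\ forall x, Kplus p phi x -> a x = cp,
                       forall x, Kminus p phi x -> a x = cm
                     & cm = A *m cp]].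

Definition Sfh (R : realType) (p : 'I_4 -> 'cV[R]_3) (phi : 'cV[R]_3 -> R)
    (A : 'M[R]_3) (xK : 'cV[R]_3) : set ('cV[R]_3 -> 'cV[R]_3) :=
  [set v | (forall x, ~ tetra p x -> v x = 0) /\
     exists c : R, exists2 a, Ah p phi A a &
       forall x, tetra p x -> v x = c *: (x - xK) + a x].

Definition ref_triangle (R : realType) : set (R * R) :=
  [set st | [/\ 0 <= st.1, 0 <= st.2 & st.1 + st.2 <= 1]].

(* Surface integral over the triangle [a, b, c], pulled back to the reference
   triangle; the factor is the Gram determinant area element. *)
Definition triangle_integral (R : realType) (a b c : 'cV[R]_3)
    (f : 'cV[R]_3 -> R) : R :=
  let u := b - a in
  let w := c - a in
  Num.sqrt (dotv u u * dotv w w - dotv u w ^+ 2) *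
  \int[((@lebesgue_measure R) \x (@lebesgue_measure R))%E]_(st in @ref_triangle R)
    f (a + st.1 *: u + st.2 *: w).

Definition face_flux (R : realType) (p nu : 'I_4 -> 'cV[R]_3)
    (v : 'cV[R]_3 -> 'cV[R]_3) (i : 'I_4) : R :=
  triangle_integral (p (lift i 0)) (p (lift i 1)) (p (lift i 2%:R))
    (fun x => dotv (v x) (nu i)).

(* Main.v *)
Require Import Defs.
From mathcomp Require Import all_boot all_order all_algebra.
From mathcomp Require Import all_classical all_reals all_analysis.
From mathcomp Require Import unstable measurable_realfun ring lra.

Import Order.TTheory GRing.Theory Num.Theory.
Import numFieldNormedType.Exports.

Local Open Scope classical_set_scope.
Local Open Scope ring_scope.

(** A field of the space is given by a scalar [c] and the constant [cp] on the
    plus side, so the four fluxes are a square linear system in [(c, cp)] and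
    it is enough to show that vanishing fluxes force [c = 0] and [cp = 0].

    Let [N i] be the gradients of the barycentric coordinates, [phi i] the
    vertex values of the level-set function, [n] the unit normal to the
    interface, [rho = alphap / alpham], and [th i] the area of the part of the
    reference triangle on which the interpolant of [phi] on the face [i] is
    nonpositive.
    As [nu i] is a nonzero multiple of [N i], and as
    [A cp - cp = y := (rho - 1) (cp - (n . cp) n)], a zero flux through the
    face [i] says, with [m0] the area of the reference triangle,
      [(c (x - xK) . N i + cp . N i) m0 + (y . N i) th i = 0]
    for any [x] in that face.

    The scalar [c] vanishes by the divergence theorem, which is used here in
    the discrete form that [\sum_i th i *: N i] is parallel to [n].  As
    [\sum_i N i = 0] and [\sum_i phi i *: N i] is the gradient of the level-set
    function, this holds because [th i] is an affine function of [phi i]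
    ([face_nonpos_area_affine]).  Indeed, integrating along one direction
    first gives [(c - a) th(a, b, c) = E(a, b) - E(b, c)], where [E] is a
    symmetric function, namely the integral over an edge of the negative part
    of the interpolant; summing such identities over three faces makes the
    points [(phi i, th i)] collinear.  Since [y] is orthogonal to [n], the sum
    of the four equations is then [- c m0 = 0].

    For [cp], put [K i := m0 + th i (rho - 1)], which is positive because
    [0 <= th i <= m0].  The equations become
      [cp . N i = (n . cp) (1 - m0 / K i) (n . N i)].
    For a trirectangular or a regular tetrahedron there are weights
    [mu i >= 0] such that [\sum_i mu i N i (N i)^T] is the identity.
    Multiplying by [mu i (n . N i)] and summing yields
      [(n . cp) \sum_i mu i (n . N i)^2 / K i = 0].
    The sum is positive, hence [n . cp = 0], then [cp . N i = 0] for all [i],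
    and [cp = 0]. *)

Set Implicit Arguments.
Unset Strict Implicit.

Local Notation mu1 := (@lebesgue_measure _).
Local Notation mu2 := (mu1 \x mu1)%E.

(** * Area of the nonpositive part of an affine function on a triangle *)

(** The part of the reference triangle where the affine function with values
    [a], [b], [c] at the vertices [(0, 0)], [(1, 0)], [(0, 1)] is nonpositive. *)
Definition nonpos_triangle (R : realType) (a b c : R) : set (R * R) :=
  @ref_triangle R `&`
  [set st | a + st.1 * (b - a) + st.2 * (c - a) <= 0].

Lemma measurable_affine_le0 (R : realType) (a b c : R) :
  measurable [set st : measurableTypeR R * measurableTypeR R |
    a + st.1 * b + st.2 * c <= 0].
Proof.
rewrite -[X in measurable X]setTI.
apply: measurable_fun_ler => //.
by do ?apply: measurable_funD => //; apply: measurable_funM.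
Qed.

Lemma measurable_ref_triangle (R : realType) :
  measurable (@ref_triangle R : set (measurableTypeR R * measurableTypeR R)).
Proof.
have -> : @ref_triangle R =
    [set st | 0 + st.1 * -1 + st.2 * 0 <= 0] `&`
    [set st | 0 + st.1 * 0 + st.2 * -1 <= 0] `&`
    [set st | -1 + st.1 * 1 + st.2 * 1 <= 0].
  by apply/seteqP; split => -[s t] /= => [[]|[[]]] /= ? ? ?; do ?split; move=> /=; lra.
by do ?apply: measurableI; exact: measurable_affine_le0.
Qed.

Lemma measurable_nonpos_triangle (R : realType) (a b c : R) :
  measurable (nonpos_triangle a b c : set (measurableTypeR R * measurableTypeR R)).
Proof.
apply: measurableI; [exact: measurable_ref_triangle|exact: measurable_affine_le0].
Qed.

Lemma ref_triangle_fin (R : realType) : (mu2 (@ref_triangle R) < +oo)%E.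
Proof.
have mX : measurable (`[0, 1]%classic `*` `[0, 1]%classic : set (R * R)).
  exact: measurableX.
apply: (@le_lt_trans _ _ (mu2 (`[0, 1]%classic `*` `[0, 1]%classic : set (R * R)))).
  apply: le_measure; rewrite ?inE //; first exact: measurable_ref_triangle.
  move=> [s t] [] /= ? ? ?; rewrite /= !in_itv /=; split; apply/andP; split; lra.
by rewrite product_measure1E //= lebesgue_measure_itv /= lte_fin ltr01 -EFinD -EFinM ltry.
Qed.

Lemma ref_triangle_gt0 (R : realType) : (0 < mu2 (@ref_triangle R))%E.
Proof.
have mX : measurable (`[0, 2^-1]%classic `*` `[0, 2^-1]%classic : set (R * R)).
  exact: measurableX.
apply: (@lt_le_trans _ _ (mu2 (`[0, 2^-1]%classic `*` `[0, 2^-1]%classic : set (R * R)))).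
  rewrite product_measure1E //= lebesgue_measure_itv /= lte_fin invr_gt0 ltr0n.
  by rewrite -EFinD -EFinM lte_fin subr0 mulr_gt0 // invr_gt0 ltr0n.
apply: le_measure; rewrite ?inE //; first exact: measurable_ref_triangle.
move=> [s t] /= [] /=; rewrite !in_itv /= => /andP[? ?] /andP[? ?]; split; move=> /=; lra.
Qed.

Definition ref_area (R : realType) : R := fine (mu2 (@ref_triangle R)).

(** The area of [nonpos_triangle]. *)
Definition nonpos_area (R : realType) (a b c : R) : R := 
  fine (mu2 (nonpos_triangle a b c)).

Lemma ref_area_gt0 (R : realType) : 0 < ref_area R.
Proof. by rewrite fine_gt0 // ref_triangle_gt0 ref_triangle_fin. Qed.

Lemma nonpos_triangle_le (R : realType) (a b c : R) :
  (mu2 (nonpos_triangle a b c) <= mu2 (@ref_triangle R))%E.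
Proof.
apply: le_measure; rewrite ?inE //.
- exact: measurable_nonpos_triangle.
- exact: measurable_ref_triangle.
by move=> x [].
Qed.

Lemma nonpos_area_bounds (R : realType) (a b c : R) :
  0 <= nonpos_area a b c <= ref_area R.
Proof.
rewrite /nonpos_area /ref_area fine_ge0 //= fine_le //; last exact: nonpos_triangle_le.
  rewrite ge0_fin_numE // (le_lt_trans (nonpos_triangle_le _ _ _)) //.
  exact: ref_triangle_fin.
by rewrite ge0_fin_numE // ref_triangle_fin.
Qed.

(** Exchanging [b] and [c] amounts to exchanging the two factors of the product
    measure. *)
Lemma nonpos_area_sym (R : realType) (a b c : R) :
  nonpos_area a b c = nonpos_area a c b.
Proof.
rewrite /nonpos_area; congr fine.
transitivity ((mu1 \x^ mu1)%E (nonpos_triangle a b c)).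
  pose m := @lebesgue_measure R : {sigma_finite_measure set _ -> \bar R}.
  pose m' := @lebesgue_measure R : {measure set _ -> \bar R}.
  have := @product_measure_unique _ _ _ _ R m m (m' \x^ m')%E.
  apply; last exact: measurable_nonpos_triangle.
  move=> A B mA mB.
  exact: (@product_measure2E _ _ _ _ R m m').
apply: eq_integral => y _ /=; congr (mu1 _).
by apply/seteqP; split => x; rewrite /xsection /ysection /= !inE;
  move=> [[]] /= ? ? ? ?; do ?split; move=> /=; lra.
Qed.

(** Integral over the reference triangle of a function with the value [k1] on
    the positive part and [k1 + k2] on the nonpositive part. *)
Lemma Rintegral_ref_step (R : realType) (a b c k1 k2 : R) :
  \int[mu2]_(st in @ref_triangle R) (k1 + k2 * \1_(nonpos_triangle a b c) st)
  = k1 * ref_area R + k2 * nonpos_area a b c.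
Proof.
have mT := @measurable_ref_triangle R.
have mN := measurable_nonpos_triangle a b c.
have i1 (k : R) : mu2.-integrable (@ref_triangle R) (EFin \o cst k).
  apply: measurable_bounded_integrable => //; first exact: ref_triangle_fin.
  exact: bounded_cst.
have i2 : mu2.-integrable (@ref_triangle R) (EFin \o (\1_(nonpos_triangle a b c))).
  apply: measurable_bounded_integrable => //; first exact: ref_triangle_fin.
  exists 1; split=> // M M1 x _ /=; rewrite indicE (le_trans _ (ltW M1)) //.
  by case: (_ \in _); rewrite ?normr0 ?normr1.
have i3 : mu2.-integrable (@ref_triangle R)
    (EFin \o (fun st => k2 * \1_(nonpos_triangle a b c) st)).
  by have := integrableZl mT k2 i2; apply: eq_integrable.
rewrite (RintegralD mT (i1 k1) i3) Rintegral_cst // (RintegralZl _ mT i2).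
congr (_ + _ * _).
rewrite /Rintegral integral_indic // /nonpos_area; congr fine; congr product_measure1.
by apply/seteqP; split => [x []|x xN] //; split => //; case: xN.
Qed.

(** The negative part of [x], as a nonnegative number. *)
Definition negpart (R : realType) (x : R) : R := Num.max (- x) 0.

(** Mean over an edge of the negative part of the affine function with values
    [a] and [b] at the end points. *)
Definition edge_integral (R : realType) (a b : R) : R :=
  \int[mu1]_(s in `[0, 1]) negpart (a + s * (b - a)).

Lemma continuous_negpart_affine (R : realType) (a b : R) :
  continuous (fun s : R => negpart (a + s * b)).
Proof.
move=> s; apply: (@continuous_max _ _ (fun s : R => - (a + s * b)) (cst 0)).
  apply: continuousN; apply: continuousD; first exact: cvg_cst.
  by apply: continuousM; [exact: cvg_id|exact: cvg_cst].
exact: cvg_cst.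
Qed.

Lemma integrable_negpart_affine (R : realType) (a b : R) :
  mu1.-integrable `[0, 1]%classic (EFin \o (fun s : R => negpart (a + s * b))).
Proof.
apply: continuous_compact_integrable; first exact: segment_compact.
by apply: continuous_subspaceT; exact: continuous_negpart_affine.
Qed.

Lemma edge_integralC (R : realType) (a b : R) : edge_integral a b = edge_integral b a.
Proof.
rewrite /edge_integral Rintegration_by_substitution_onem; first last.
- by apply: continuous_subspaceT; exact: continuous_negpart_affine.
- by rewrite lexx ler01.
rewrite onem1; apply: eq_Rintegral => s _.
by congr negpart; rewrite /onem; ring.
Qed.

(** The part of [[0, L]] where the affine function of slope [q] and value [r]
    at [0] is nonpositive. *)
Definition nonpos_slice (R : realType) (L q r : R) : set R :=
  [set t | 0 <= t <= L /\ r + t * q <= 0].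

Lemma length_max0 (R : realType) (x y : R) :
  (if x < y then (y - x)%:E else 0%E) = (Num.max (y - x) 0)%:E.
Proof. by rewrite -subr_gt0; case: (ltP 0 (y - x)). Qed.

(** Since [- negpart] is a primitive of the indicator function of the
    nonpositive numbers, the length is a difference quotient of it. *)
Lemma nonpos_slice_length (R : realType) (L q r : R) : 0 <= L -> q != 0 ->
  mu1 (nonpos_slice L q r) = (q^-1 * (negpart r - negpart (r + L * q)))%:E.
Proof.
(* [z] is the zero of the affine function. *)
move=> L0 q0; have [z zE] : exists z, r = - z * q.
  by exists (- (r / q)); rewrite opprK divfK.
have [qgt|qlt|qe] := ltgtP q 0; last by rewrite qe eqxx in q0.
- have -> : nonpos_slice L q r = [set` `[Num.max 0 z, L]].
    apply/seteqP; split => t; rewrite /nonpos_slice /= in_itv /= ge_max.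
      move=> [/andP[-> ->] h]; rewrite andbT /= -(ler_nM2r qgt).
      by move: h; rewrite zE; lra.
    move=> /andP[/andP[-> h] ->]; split=> //.
    by move: h; rewrite -(ler_nM2r qgt) zE; lra.
  rewrite lebesgue_measure_itv /= lte_fin -EFinB length_max0.
  congr EFin; rewrite /negpart zE; apply: (mulfI q0); rewrite mulrA mulfV // mul1r.
  by case: (leP 0 z) => ?; case: leP => ?; case: leP => ?; case: leP => ?; nra.
- have -> : nonpos_slice L q r = [set` `[0, Num.min L z]].
    apply/seteqP; split => t; rewrite /nonpos_slice /= in_itv /= le_min.
      move=> [/andP[-> ->] h]; rewrite /= -(ler_pM2r qlt).
      by move: h; rewrite zE; lra.
    move=> /and3P[-> -> h]; split=> //.
    by move: h; rewrite -(ler_pM2r qlt) zE; lra.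
  rewrite lebesgue_measure_itv /= lte_fin -EFinB length_max0.
  congr EFin; rewrite /negpart zE; apply: (mulfI q0); rewrite mulrA mulfV // mul1r.
  by case: (leP L z) => ?; case: leP => ?; case: leP => ?; case: leP => ?; nra.
Qed.

(** Integration in the second coordinate first; the slice at [s] runs from the
    edge with values [a], [b] to the edge with values [c], [b]. *)
Lemma nonpos_area_edge (R : realType) (a b c : R) :
  (c - a) * nonpos_area a b c = edge_integral a b - edge_integral c b.
Proof.
have [->|ca] := eqVneq c a; first by rewrite !subrr mul0r.
have q0 : c - a != 0 by rewrite subr_eq0.
have -> : nonpos_area a b c = \int[mu1]_(s in `[0, 1])
   ((c - a)^-1 * (negpart (a + s * (b - a)) - negpart (c + s * (b - c)))).
  rewrite /nonpos_area /Rintegral; congr fine.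
  rewrite [RHS]integral_mkcond; apply: eq_integral => s _.
  rewrite patchE; case: ifPn => [|hs].
    rewrite inE /= in_itv /= => /andP[s0 s1].
    transitivity (mu1 (nonpos_slice (1 - s) (c - a) (a + s * (b - a)))).
      congr (mu1 _); rewrite /xsection; apply/seteqP; split => t /=; rewrite inE.
        by move=> [[]] /= *; split => //; apply/andP; split => //; lra.
      by move=> [/andP[t0 t1] h]; do ?split => //; move=> /=; lra.
    by rewrite nonpos_slice_length ?subr_ge0 //; congr (_ * (_ - negpart _))%:E; ring.
  transitivity (mu1 (set0 : set R)); last by rewrite measure0.
  congr (mu1 _); rewrite /xsection; apply/seteqP.
  split => t; last by case.
  rewrite /= inE => -[[]] /= s0 t0 st _.
  by move/negP: hs; apply; apply/mem_set; rewrite /= in_itv /= s0 /=; lra.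
have i1 := integrable_negpart_affine a (b - a).
have i2 := integrable_negpart_affine c (b - c).
have m01 : measurable (`[0, 1]%classic : set (measurableTypeR R)) by [].
have i3 := integrableB m01 i1 i2.
by rewrite (RintegralZl _ m01 i3) (RintegralB m01 i1 i2) mulrA mulfV // mul1r.
Qed.

(** The same relation for the three pairs of vertices; unlike a closed formula
    for the area, it needs no distinction between equal and distinct values. *)
Lemma nonpos_area_relations (R : realType) (a b c : R) :
  [/\ (c - a) * nonpos_area a b c = edge_integral a b - edge_integral b c,
      (b - a) * nonpos_area a b c = edge_integral a c - edge_integral b c &
      (c - b) * nonpos_area a b c = edge_integral a b - edge_integral a c].
Proof.
have h1 : (c - a) * nonpos_area a b c = edge_integral a b - edge_integral b c.
  by rewrite nonpos_area_edge (edge_integralC c b).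
have h2 : (b - a) * nonpos_area a b c = edge_integral a c - edge_integral b c.
  by rewrite nonpos_area_sym nonpos_area_edge.
split => //; lra.
Qed.

(** If [(xi, ti)], [(xj, tj)], [(xk, tk)] are collinear and [xi != xj], then the
    third point is on the line through the first two. *)
Lemma collinear_affine (R : fieldType) (xi xj xk ti tj tk : R)
    (D := (ti - tj) / (xi - xj)) :
  xi != xj -> (xi - xj) * tk + (xj - xk) * ti + (xk - xi) * tj = 0 ->
  tk = D * xk + (ti - D * xi).
Proof.
move=> nij; have n0 : xi - xj != 0 by rewrite subr_eq0.
have -> : tj = ti - D * (xi - xj) by rewrite divfK // subKr.
by move=> h; apply: (mulfI n0); apply/eqP; rewrite -subr_eq0 -h; apply/eqP; ring.
Qed.

(** [xi] is the value at the vertex [i] of a tetrahedron, and it is matched with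
    the area on the face opposite to that vertex. *)
Lemma nonpos_area_affine (R : realType) (x0 x1 x2 x3 : R) :
  ~ (x0 = x1 /\ x0 = x2 /\ x0 = x3) ->
  exists D e, [/\ nonpos_area x1 x2 x3 = D * x0 + e, nonpos_area x0 x2 x3 = D * x1 + e,
    nonpos_area x0 x1 x3 = D * x2 + e & nonpos_area x0 x1 x2 = D * x3 + e].
Proof.
have [h1 h2 h3] := nonpos_area_relations x1 x2 x3.
have [h4 h5 h6] := nonpos_area_relations x0 x2 x3.
have [h7 h8 h9] := nonpos_area_relations x0 x1 x3.
have [h10 h11 h12] := nonpos_area_relations x0 x1 x2.
move: h1 h2 h3 h4 h5 h6 h7 h8 h9 h10 h11 h12.
set t0 := nonpos_area x1 x2 x3; set t1 := nonpos_area x0 x2 x3.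
set t2 := nonpos_area x0 x1 x3; set t3 := nonpos_area x0 x1 x2.
move=> h1 h2 h3 h4 h5 h6 h7 h8 h9 h10 h11 h12 ne.
(* In each of these sums over three faces the edge integrals cancel in pairs. *)
have r1 : (x0 - x1) * t2 + (x1 - x2) * t0 + (x2 - x0) * t1 = 0 by lra.
have r2 : (x0 - x1) * t3 + (x1 - x3) * t0 + (x3 - x0) * t1 = 0 by lra.
have r3 : (x0 - x2) * t3 + (x2 - x3) * t0 + (x3 - x0) * t2 = 0 by lra.
clear h1 h2 h3 h4 h5 h6 h7 h8 h9 h10 h11 h12.
have [e1|n1] := eqVneq x0 x1; last first.
  exists ((t0 - t1) / (x0 - x1)), (t0 - (t0 - t1) / (x0 - x1) * x0).
  by split; apply: collinear_affine n1 _; clear -r1 r2; lra.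
have [e2|n2] := eqVneq x0 x2; last first.
  exists ((t0 - t2) / (x0 - x2)), (t0 - (t0 - t2) / (x0 - x2) * x0).
  by split; apply: collinear_affine n2 _; clear -r1 r3; lra.
have [e3|n3] := eqVneq x0 x3; last first.
  exists ((t0 - t3) / (x0 - x3)), (t0 - (t0 - t3) / (x0 - x3) * x0).
  by split; apply: collinear_affine n3 _; clear -r2 r3; lra.
by case: ne.
Qed.

(** * Barycentric gradients and the homogeneous system *)

Section Dot.
Variable R : realType.
Implicit Types u v x : 'cV[R]_3.

Lemma dotvE u v : dotv u v = \sum_k u k 0 * v k 0.
Proof. by rewrite /dotv mxE; apply: eq_bigr => k _; rewrite mxE. Qed.

Lemma dotvC u v : dotv u v = dotv v u.
Proof. by rewrite !dotvE; apply: eq_bigr => k _; rewrite mulrC. Qed.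

Lemma dotvDr u v x : dotv u (v + x) = dotv u v + dotv u x.
Proof. by rewrite /dotv mulmxDr mxE. Qed.

Lemma dotvZr a u v : dotv u (a *: v) = a * dotv u v.
Proof. by rewrite /dotv -scalemxAr mxE. Qed.

Lemma dotvNr u v : dotv u (- v) = - dotv u v.
Proof. by rewrite -scaleN1r dotvZr mulN1r. Qed.

Lemma dotvBr u v x : dotv u (v - x) = dotv u v - dotv u x.
Proof. by rewrite dotvDr dotvNr. Qed.

Lemma dotv0r u : dotv u 0 = 0.
Proof. by rewrite /dotv mulmx0 mxE. Qed.

Lemma dotvZl a u v : dotv (a *: v) u = a * dotv v u.
Proof. by rewrite ![dotv _ u]dotvC dotvZr. Qed.

Lemma dotvBl u v x : dotv (v - x) u = dotv v u - dotv x u.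
Proof. by rewrite ![dotv _ u]dotvC dotvBr. Qed.

Lemma dotv_sumr (I : finType) u (F : I -> 'cV[R]_3) :
  dotv u (\sum_i F i) = \sum_i dotv u (F i).
Proof.
by apply: (big_morph (dotv u)); [move=> ? ?; rewrite dotvDr|rewrite dotv0r].
Qed.

Lemma dotv_suml (I : finType) u (F : I -> 'cV[R]_3) :
  dotv (\sum_i F i) u = \sum_i dotv (F i) u.
Proof. by rewrite dotvC dotv_sumr; apply: eq_bigr => i _; rewrite dotvC. Qed.

Lemma dotvv_ge0 u : 0 <= dotv u u.
Proof. by rewrite dotvE sumr_ge0 // => k _; rewrite -expr2 sqr_ge0. Qed.

Lemma dotvv_eq0 u : dotv u u = 0 -> u = 0.
Proof.
rewrite dotvE => /eqP; rewrite psumr_eq0 => [/allP h|k _]; last first.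
  by rewrite -expr2 sqr_ge0.
apply/colP => k; rewrite mxE.
by have := h k (mem_index_enum k); rewrite /= mulf_eq0 orbb => /eqP.
Qed.

Lemma dotvv_gt0 u : u != 0 -> 0 < dotv u u.
Proof.
move=> u0; rewrite lt_def dotvv_ge0 andbT; apply: contra u0 => /eqP h.
by rewrite (dotvv_eq0 h).
Qed.

Lemma dotv_inj u v : (forall x, dotv u x = dotv v x) -> u = v.
Proof.
move=> h; apply/eqP; rewrite -subr_eq0; apply/eqP/dotvv_eq0.
by rewrite dotvBl h subrr.
Qed.
End Dot.

Section Bary.
Variables (R : realType) (p : 'I_4 -> 'cV[R]_3).

(** [N i] is the gradient of the barycentric coordinate of the vertex [p i]. *)
Definition is_bary_grad (N : 'I_4 -> 'cV[R]_3) : Prop :=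
  [/\ \sum_i N i = 0, forall x, x = \sum_i dotv (N i) x *: p i
    & forall i j k, dotv (N i) (p j - p k) = (i == j)%:R - (i == k)%:R].

Lemma bary_grad_exists : nondegenerate_tetra p -> exists N, is_bary_grad N.
Proof.
rewrite /nondegenerate_tetra; set M := (\matrix_(k, j) _) => detM.
have uM : M \in unitmx by rewrite unitmxE unitfE.
(* The rows of [invmx M] are the basis dual to the edges issued from [p ord0]. *)
pose r (j : 'I_3) : 'cV[R]_3 := (row j (invmx M))^T.
have rE j x : dotv (r j) x = (invmx M *m x) j 0.
  by rewrite dotvE !mxE; apply: eq_bigr => k _; rewrite !mxE.
have rM j l : dotv (r j) (p (lift ord0 l) - p ord0) = (j == l)%:R.
  have -> : p (lift ord0 l) - p ord0 = col l M by apply/colP => k; rewrite !mxE.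
  by rewrite rE colE mulmxA mulVmx // mul1mx mxE eqxx andbT.
have [N N0 NS] : exists2 N : 'I_4 -> 'cV[R]_3,
    N ord0 = - \sum_j r j & forall j : 'I_3, N (lift ord0 j) = r j.
  exists (fun i => if unlift ord0 i is Some j then r j else - \sum_j r j).
    by rewrite unlift_none.
  by move=> j; rewrite liftK.
exists N; split.
- by rewrite big_ord_recl; under eq_bigr do rewrite NS; rewrite N0 addNr.
- move=> x; rewrite big_ord_recl.
  under eq_bigr do rewrite NS.
  rewrite N0 [dotv (- _) x]dotvC dotvNr dotv_sumr scaleNr scaler_suml addrC -sumrB.
  under eq_bigr do rewrite [dotv x _]dotvC -scalerBr rE.
  rewrite -[LHS]mul1mx -(mulmxV uM) -mulmxA.
  apply/colP => k; rewrite mxE summxE; apply: eq_bigr => j _.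
  by rewrite !mxE mulrC.
- have h i j : dotv (N i) (p j - p ord0) = (i == j)%:R - (i == ord0)%:R.
    case: (unliftP ord0 j) => [j'|] ->; last by rewrite !subrr dotv0r.
    case: (unliftP ord0 i) => [i'|] ->.
      rewrite NS rM (inj_eq lift_inj) [_ == ord0]eq_sym (negbTE (neq_lift _ _)).
      by rewrite subr0.
    rewrite N0 dotvC dotvNr dotv_sumr (negbTE (neq_lift _ _)) eqxx sub0r.
    rewrite (bigD1 j') //= dotvC rM eqxx big1 ?addr0 // => l lj.
    by rewrite dotvC rM (negbTE lj).
  move=> i j k; have -> : p j - p k = (p j - p ord0) - (p k - p ord0).
    by rewrite opprB addrA subrK.
  by rewrite dotvBr !h opprB addrA subrK.
Qed.

Variable N : 'I_4 -> 'cV[R]_3.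
Hypothesis hN : is_bary_grad N.

Lemma bary_grad_sum x : \sum_i dotv x (N i) = 0.
Proof. by have [h _ _] := hN; rewrite -dotv_sumr h dotv0r. Qed.

Lemma bary_grad_affine g : g = \sum_i dotv g (p i) *: N i.
Proof.
have [_ h _] := hN; apply: dotv_inj => x; rewrite {1}(h x) dotv_sumr dotv_suml.
by apply: eq_bigr => i _; rewrite dotvZr dotvZl mulrC.
Qed.

Lemma normal_bary_grad nu : unit_face_normals p nu ->
  exists s : 'I_4 -> R, forall i, s i != 0 /\ nu i = s i *: N i.
Proof.
move=> hnu; exists (fun i => dotv (nu i) (p i - p (lift i 0))) => i.
have [n1 ort] := hnu i; set s := dotv _ _.
have e : nu i = s *: N i.
  rewrite {1}(bary_grad_affine (nu i)) (bigD1 i) //=.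
  have [h0 _ _] := hN.
  have -> : N i = - \sum_(j | j != i) N j.
    by move/eqP: h0; rewrite (bigD1 i) //= addr_eq0 => /eqP.
  rewrite scalerN scalerN !scaler_sumr -sumrN -sumrN -big_split /=.
  apply: eq_bigr => j ji.
  rewrite -!scaleNr -scalerDl /s dotvBr opprB; congr (_ *: _).
  have := ort j (lift i 0) ji; rewrite eq_sym neq_lift dotvBr => /(_ isT) /eqP.
  by rewrite subr_eq0 => /eqP ->; rewrite addrC.
split=> //; apply/eqP => s0; move: n1; rewrite e s0 scale0r /enorm dotv0r sqrtr0.
by move/eqP; rewrite eq_sym oner_eq0.
Qed.

(** Nonnegative weights [mu] with [\sum_i mu i N i (N i)^T] equal to the
    identity. *)
Definition frame_weights (mu : 'I_4 -> R) : Prop :=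
  (forall i, 0 <= mu i) /\
  forall x y, dotv x y = \sum_i mu i * (dotv x (N i) * dotv y (N i)).

(** Three of the normals form an orthonormal basis, and each of them is a
    multiple of the corresponding barycentric gradient; the remaining face
    gets weight zero. *)
Lemma frame_weights_trirectangular nu : unit_face_normals p nu ->
  trirectangular_tetra nu -> exists mu, frame_weights mu.
Proof.
move=> hnu [i0 ort]; have [s hs] := normal_bary_grad hnu.
pose O := \matrix_(k < 3, j < 3) nu (lift i0 k) j 0.
have OE k l : (O *m O^T) k l = dotv (nu (lift i0 k)) (nu (lift i0 l)).
  by rewrite dotvE mxE; apply: eq_bigr => j _; rewrite !mxE.
have OO : O *m O^T = 1%:M.
  apply/matrixP => k l; rewrite OE mxE.
  have [->|kl] := eqVneq k l.
    have [] := hnu (lift i0 l); rewrite /enorm => h _.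
    by rewrite -[LHS]sqr_sqrtr ?dotvv_ge0 // h expr1n.
  by rewrite ort ?(inj_eq lift_inj) // eq_sym neq_lift.
have OO' := mulmx1C OO.
exists (fun i => if i == i0 then 0 else s i ^+ 2); split=> [i|x y].
  by case: eqP => // _; rewrite sqr_ge0.
rewrite (bigD1_ord i0) //= eqxx mul0r add0r.
have -> : dotv x y = \sum_k (O *m x) k 0 * (O *m y) k 0.
  rewrite /dotv -[y in LHS]mul1mx -OO' -mulmxA mulmxA -trmx_mul mxE.
  by apply: eq_bigr => k _; rewrite mxE.
apply: eq_bigr => k _; rewrite eq_sym (negbTE (neq_lift _ _)).
have e z : (O *m z) k 0 = s (lift i0 k) * dotv z (N (lift i0 k)).
  have [_ h] := hs (lift i0 k); rewrite -dotvZr -h dotvC dotvE mxE.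
  by apply: eq_bigr => j _; rewrite mxE.
by rewrite !e; ring.
Qed.

(** With [l] the edge length, all weights are [l ^+ 2 / 2].  This follows by
    expanding [x . y] through [x = \sum_i (N i . x) p i] and replacing
    [p i . p j] by [(|p i|^2 + |p j|^2 - |p i - p j|^2) / 2]; the terms that
    depend on one index only disappear because [\sum_i N i = 0]. *)
Lemma frame_weights_regular : regular_tetra p -> exists mu, frame_weights mu.
Proof.
move=> [l hl]; exists (fun=> l ^+ 2 / 2); split=> [i|x y].
  by rewrite divr_ge0 // sqr_ge0.
have [_ h _] := hN.
have dij i j : dotv (p i - p j) (p i - p j) = l ^+ 2 * (i != j)%:R.
  have [->|ij] := eqVneq i j; first by rewrite subrr dotv0r mulr0.
  by rewrite mulr1 -(hl i j ij) sqr_sqrtr // dotvv_ge0.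
have pij i j : dotv (p i) (p j) =
    (dotv (p i) (p i) + dotv (p j) (p j)) / 2 - l ^+ 2 / 2 * (i != j)%:R.
  have := dij i j; rewrite dotvBr !dotvBl [dotv (p j) (p i)]dotvC; lra.
have -> : dotv x y = \sum_i \sum_j dotv x (N i) * dotv y (N j) * dotv (p i) (p j).
  rewrite {1}(h x) {1}(h y) dotv_suml; apply: eq_bigr => i _.
  rewrite dotvZl dotv_sumr mulr_sumr; apply: eq_bigr => j _.
  by rewrite dotvZr ![dotv (N _) _]dotvC; ring.
pose P i := dotv (p i) (p i) / 2.
have s1 i : \sum_j dotv x (N i) * dotv y (N j) * dotv (p i) (p j) =
   dotv x (N i) * \sum_j dotv y (N j) * P j
   + (l ^+ 2 / 2) * (dotv x (N i) * dotv y (N i)).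
  transitivity (\sum_j (dotv x (N i) * (dotv y (N j) * P j)
    + (dotv x (N i) * (P i - l ^+ 2 / 2)) * dotv y (N j)
    + (if j == i then (l ^+ 2 / 2) * (dotv x (N i) * dotv y (N i)) else 0))).
    apply: eq_bigr => j _; rewrite pij /P eq_sym.
    by have [->|_] := eqVneq j i; rewrite /=; field.
  rewrite !big_split /= -!mulr_sumr bary_grad_sum mulr0 addr0; congr (_ + _).
  by rewrite -big_mkcond big_pred1_eq.
under eq_bigr do rewrite s1.
by rewrite big_split /= -mulr_suml bary_grad_sum mul0r add0r.
Qed.

End Bary.

(** [AK] acts as the identity along the normal [n] and as the multiplication by
    [rho] in the tangent plane. *)
Lemma AK_mulE (R : realType) (T : 'M[R]_3) (ap am : R) (x : 'cV[R]_3)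
    (n := col 0 T) (rho := ap / am) :
  T^T *m T = 1%:M ->
  AK T ap am *m x = rho *: x + ((1 - rho) * dotv n x) *: n.
Proof.
move=> /mulmx1C TT.
have -> : AK T ap am = rho *: 1%:M + (1 - rho) *: (n *m n^T).
  apply/matrixP => k l; rewrite -TT /AK -/rho !mxE [in RHS]big_ord_recl.
  rewrite [in LHS]big_ord_recl big_ord1 !mul_mx_diag !mxE eqxx mulrDr mulr_sumr.
  rewrite addrAC; congr (_ + _); first by ring.
  by apply: eq_bigr => j _; rewrite !mxE [_ == 0]eq_sym (negbTE (neq_lift _ _)); ring.
rewrite mulmxDl -!scalemxAl mul1mx -mulmxA [n^T *m x]mx11_scalar mul_mx_scalar.
by rewrite scalerA.
Qed.

(** Each summand is the opposite of a barycentric coordinate of [x]. *)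
Lemma sum_bary_grad_to_point (R : realType) (p N : 'I_4 -> 'cV[R]_3) (x : 'cV[R]_3) :
  is_bary_grad p N -> tetra p x ->
  \sum_(i < 4) dotv (p (lift i 0) - x) (N i) = -1.
Proof.
move=> [_ _ hN] [l [_ l1 ->]].
rewrite -l1 -[RHS]sumrN; apply: eq_bigr => i _.
have -> : p (lift i 0) - \sum_j l j *: p j = \sum_j l j *: (p (lift i 0) - p j).
  rewrite -[p (lift i 0)]scale1r -{1}l1 scaler_suml -sumrB.
  by apply: eq_bigr => j _; rewrite scale1r scalerBr.
rewrite dotv_suml (bigD1 i) //= big1 ?addr0 => [|j ji].
  by rewrite dotvZl dotvC hN eqxx (negbTE (neq_lift _ _)) sub0r mulrN1.
by rewrite dotvZl dotvC hN (negbTE (neq_lift _ _)) eq_sym (negbTE ji) subrr mulr0.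
Qed.

(** The homogeneous system has only the trivial solution.  Here [m0] stands for
    the area of the reference triangle, [th i] for the area of its nonpositive
    part on the face [i], and [y] for the jump [A cp - cp] of the piecewise
    constant part. *)
Lemma zero_flux_eq0 (R : realType) (p N : 'I_4 -> 'cV[R]_3) (mu th : 'I_4 -> R)
    (g n xK cp : 'cV[R]_3) (s b D e m0 rho c : R)
    (y : 'cV[R]_3 := (rho - 1) *: (cp - dotv n cp *: n)) :
  is_bary_grad p N -> frame_weights N mu -> tetra p xK ->
  n = s *: g -> dotv n n = 1 -> 0 < rho -> 0 < m0 ->
  (forall i, 0 <= th i <= m0) -> (forall i, th i = D * (dotv g (p i) + b) + e) ->
  (forall i : 'I_4, (c * dotv (p (lift i 0) - xK) (N i) + dotv cp (N i)) * m0
             + dotv y (N i) * th i = 0) ->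
  c = 0 /\ cp = 0.
Proof.
move=> hN [mu0 hmu] hxK ng nn rho0 m00 thb thE h.
have s0 : s != 0.
  by apply/eqP => s0; move: nn; rewrite ng s0 scale0r dotv0r => /esym/eqP; rewrite oner_eq0.
have ny : dotv n y = 0.
  by rewrite /y dotvZr dotvBr dotvZr nn mulr1 subrr mulr0.
have gy : dotv y g = 0.
  by apply: (mulfI s0); rewrite mulr0 -dotvZr -ng dotvC.
(* Summing the four equations leaves only the divergence term. *)
have c0 : c = 0.
  have : \sum_(i < 4) ((c * dotv (p (lift i 0) - xK) (N i) + dotv cp (N i)) * m0
             + dotv y (N i) * th i) = 0 by rewrite big1.
  rewrite big_split /= -mulr_suml big_split /= -mulr_sumr (sum_bary_grad_to_point hN) //.
  rewrite (bary_grad_sum hN) addr0.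
  have -> : \sum_i dotv y (N i) * th i = 0.
    transitivity (\sum_i (D * dotv y (dotv g (p i) *: N i) + (D * b + e) * dotv y (N i))).
      by apply: eq_bigr => i _; rewrite thE dotvZr; ring.
    rewrite big_split /= -!mulr_sumr (bary_grad_sum hN) mulr0 addr0.
    by rewrite -dotv_sumr -(bary_grad_affine hN) gy mulr0.
  by rewrite addr0 mulrN1 => /eqP; rewrite mulf_eq0 (gt_eqF m00) orbF oppr_eq0 => /eqP.
split=> //; set S := dotv n cp.
(* The [N i] form a weighted tight frame, so that [S] is [dotv n cp] computed
   from the [dotv cp (N i)], which are themselves multiples of [S]. *)
pose K i := m0 + th i * (rho - 1).
have K0 i : 0 < K i.
  have /andP[t0 t1] := thb i; rewrite /K; have [->|t0'] := eqVneq (th i) 0; first lra.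
  have : 0 < th i * rho by rewrite mulr_gt0 // lt_def t0' t0.
  lra.
have eN i : dotv cp (N i) = S * dotv n (N i) - m0 * S * dotv n (N i) / K i.
  apply: (mulfI (lt0r_neq0 (K0 i))); rewrite mulrBr [X in _ = _ - X]mulrC.
  rewrite divfK ?lt0r_neq0 //; apply/eqP; rewrite -subr_eq0 -(h i) c0.
  by rewrite mul0r add0r /y dotvZl dotvBl dotvZl -/S /K; apply/eqP; ring.
pose Z i := mu i * (dotv n (N i) * dotv n (N i)).
have Z0 i : 0 <= Z i by rewrite mulr_ge0 // -expr2 sqr_ge0.
have sZ : \sum_i Z i = 1 by rewrite -hmu.
have S0 : S = 0.
  have : S = S * (\sum_i Z i) - m0 * S * \sum_i (Z i / K i).
    rewrite {1}/S hmu !mulr_sumr -sumrB; apply: eq_bigr => i _.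
    by rewrite eN /Z; ring.
  rewrite sZ mulr1 => /eqP; rewrite -subr_eq0 opprB addrC subrK mulf_eq0.
  rewrite mulf_eq0 (gt_eqF m00) /= => /orP[/eqP //|].
  rewrite psumr_eq0 => [/allP hz|i _]; last by rewrite divr_ge0 // ltW.
  move: sZ; rewrite big1 => [/eqP|i _]; first by rewrite eq_sym oner_eq0.
  have := hz i (mem_index_enum i).
  by rewrite /= mulf_eq0 invr_eq0 (gt_eqF (K0 i)) orbF => /eqP.
apply: dotvv_eq0; rewrite hmu big1 // => i _.
by rewrite eN S0 mulr0 !mul0r subrr mul0r mulr0.
Qed.

(** * Fluxes of the interface fields *)

(** [nonpos_area] for the values of [f] at the vertices of the face [i]. *)
Definition face_nonpos_area (R : realType) (f : 'I_4 -> R) (i : 'I_4) : R :=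
  nonpos_area (f (lift i 0)) (f (lift i 1)) (f (lift i 2%:R)).

Lemma face_nonpos_area_affine (R : realType) (f : 'I_4 -> R) :
  ~ (forall i j, f i = f j) ->
  exists D e, forall i, face_nonpos_area f i = D * f i + e.
Proof.
move=> ne; pose x k := f (inord k).
have fE i : f i = x (val i) by rewrite /x inord_val.
have [[h1 [h2 h3]]|D [e [h0 h1 h2 h3]]] := @nonpos_area_affine R (x 0) (x 1) (x 2) (x 3).
  apply: ne; suff h i : f i = x 0 by move=> i j; rewrite !h.
  by rewrite fE; case: i => [[|[|[|[|//]]]] hi] /=.
exists D, e => i; rewrite /face_nonpos_area !fE.
by case: i => [[|[|[|[|//]]]] hi].
Qed.

Lemma interface_not_constant (R : realType) (p : 'I_4 -> 'cV[R]_3) phi :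
  interface_element p phi -> ~ forall i j, phi (p i) = phi (p j).
Proof.
rewrite /interface_element => + h.
have [v e] : exists v, forall i, phi (p i) = v by exists (phi (p ord0)).
by rewrite !big_ord_recl !big_ord0 !e !minxx !maxxx -expr2 ltNge sqr_ge0.
Qed.

Section Field.
Variables (R : realType) (p : 'I_4 -> 'cV[R]_3) (phi : 'cV[R]_3 -> R).
Variables (A : 'M[R]_3) (xK : 'cV[R]_3).

(** The field [c (x - xK) + cp] on the plus part and [c (x - xK) + A cp] on the
    minus part, which contains the interface; zero outside of the tetrahedron. *)
Definition interface_field (c : R) (cp : 'cV[R]_3) (x : 'cV[R]_3) : 'cV[R]_3 :=
  if `[< tetra p x >] then
    c *: (x - xK) + (if phi x <= 0 then A *m cp else cp)
  else 0.

Lemma SfhP v : Sfh p phi A xK v <-> exists c cp, v = interface_field c cp.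
Proof.
split=> [[v0 [c [a [a0 [cp [cm [hp hm cmE]]]] hv]]]|[c [cp ->]]].
  exists c, cp; apply/funext => x; rewrite /interface_field; case: asboolP => [Kx|/v0 //].
  rewrite hv //; congr (_ + _); case: leP => h.
    by rewrite -cmE hm.
  by rewrite hp.
split=> [x hx|]; first by rewrite /interface_field; case: asboolP.
exists c, (fun x => if `[< tetra p x >] then (if phi x <= 0 then A *m cp else cp) else 0).
  split=> [x hx|]; first by case: asboolP.
  exists cp, (A *m cp); split=> // x [Kx h]; case: asboolP => // _.
    by rewrite leNgt h.
  by rewrite h.
by move=> x Kx; rewrite /interface_field; case: asboolP.
Qed.

End Field.

(** The parametrization of the triangle [p i], [p j], [p k] by the reference
    triangle takes values in the tetrahedron. *)
Lemma tetra_triangle (R : realType) (p : 'I_4 -> 'cV[R]_3) (i j k : 'I_4) (s t : R) :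
  0 <= s -> 0 <= t -> s + t <= 1 ->
  tetra p (p i + s *: (p j - p i) + t *: (p k - p i)).
Proof.
move=> s0 t0 st.
exists (fun l => (1 - s - t) * (l == i)%:R + s * (l == j)%:R + t * (l == k)%:R).
have sel (V : lmodType R) (F : 'I_4 -> V) m : \sum_l (l == m)%:R *: F l = F m.
  rewrite (bigD1 m) //= eqxx scale1r big1 ?addr0 // => l /negbTE ->.
  by rewrite scale0r.
have sel1 m : \sum_(l < 4) (l == m)%:R = 1 :> R.
  by rewrite -[RHS](sel R^o (fun=> 1) m); apply: eq_bigr => l _;
     rewrite /GRing.scale /= mulr1.
split=> [l||].
- by rewrite !addr_ge0 // mulr_ge0 ?ler0n //; lra.
- by rewrite !big_split /= -!mulr_sumr !sel1; ring.
- under eq_bigr do rewrite !scalerDl -!scalerA.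
  rewrite !big_split /= -!scaler_sumr !sel.
  by apply/colP => l; rewrite !mxE; ring.
Qed.

(** The area of the parallelogram spanned by [u] and [w]. *)
Definition area_factor (R : realType) (u w : 'cV[R]_3) : R :=
  Num.sqrt (dotv u u * dotv w w - dotv u w ^+ 2).

Lemma area_factor_gt0 (R : realType) (u w m : 'cV[R]_3) :
  dotv m u = 0 -> dotv m w = 1 -> u != 0 -> 0 < area_factor u w.
Proof.
move=> mu mw u0; have uu := dotvv_gt0 u0.
(* [dotv u u] times the Gram determinant is the squared norm of a multiple of
   the component of [w] orthogonal to [u]. *)
have z0 : 0 < dotv (dotv u u *: w - dotv u w *: u) (dotv u u *: w - dotv u w *: u).
  apply: dotvv_gt0; apply/eqP => /(congr1 (dotv m)).
  rewrite dotvBr !dotvZr mu mw dotv0r => /eqP; rewrite mulr0 subr0 mulr1.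
  by rewrite gt_eqF.
rewrite sqrtr_gt0 -(pmulr_rgt0 _ uu); apply: lt_le_trans z0 _.
rewrite !(dotvBl, dotvBr, dotvZl, dotvZr) (dotvC w u) le_eqVlt.
by apply/orP; left; apply/eqP; ring.
Qed.

(** On a face [(x - xK) . nu i] is constant, so the integrand of the flux takes
    two values, according to the sign of the level-set function. *)
Lemma face_flux_interface_field (R : realType) (p nu : 'I_4 -> 'cV[R]_3) (g : 'cV[R]_3)
  (b : R) (A : 'M[R]_3) (xK : 'cV[R]_3) (c : R) (cp : 'cV[R]_3) (i : 'I_4) :
  unit_face_normals p nu ->
  face_flux p nu (interface_field p (affine_fun g b) A xK c cp) i =
  area_factor (p (lift i 1) - p (lift i 0)) (p (lift i 2%:R) - p (lift i 0)) *
  ((c * dotv (p (lift i 0) - xK) (nu i) + dotv cp (nu i)) * ref_area R +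
   dotv (A *m cp - cp) (nu i) * face_nonpos_area (fun j => affine_fun g b (p j)) i).
Proof.
move=> hnu; rewrite /face_flux /triangle_integral; congr (_ * _).
rewrite -Rintegral_ref_step; apply: eq_Rintegral => -[s t]; rewrite inE => -[/= s0 t0 st].
set a := p _; set b1 := p _; set c1 := p _.
have [_ ort] := hnu i.
have o1 : dotv (nu i) b1 = dotv (nu i) a.
  by apply/eqP; rewrite -subr_eq0 -dotvBr ort // eq_sym neq_lift.
have o2 : dotv (nu i) c1 = dotv (nu i) a.
  by apply/eqP; rewrite -subr_eq0 -dotvBr ort // eq_sym neq_lift.
have phiE : affine_fun g b (a + s *: (b1 - a) + t *: (c1 - a)) =
  affine_fun g b a + s * (affine_fun g b b1 - affine_fun g b a)
   + t * (affine_fun g b c1 - affine_fun g b a).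
  by rewrite /affine_fun !(dotvDr, dotvZr, dotvNr); ring.
rewrite /interface_field; case: asboolP => [_|]; last by case; exact: tetra_triangle.
rewrite indicE phiE.
have -> : ((s, t) \in nonpos_triangle (affine_fun g b a) (affine_fun g b b1)
    (affine_fun g b c1))
  = (affine_fun g b a + s * (affine_fun g b b1 - affine_fun g b a)
   + t * (affine_fun g b c1 - affine_fun g b a) <= 0).
  by apply/idP/idP => [|h]; [rewrite inE => -[]|apply/mem_set; split].
rewrite !(dotvC _ (nu i)) !(dotvDr, dotvZr, dotvNr) o1 o2.
by case: (_ <= 0) => /=; ring.
Qed.

(** A square linear system with trivial kernel is solvable, for the unknowns [c]
    and [x] of sizes 1 and 3. *)
Lemma linear_system_solvable (R : fieldType) (al : 'I_4 -> R) (be : 'I_4 -> 'cV[R]_3) :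
  (forall (c : R) (x : 'cV[R]_3), (forall i, c * al i + (x^T *m be i) 0 0 = 0) ->
     c = 0 /\ x = 0) ->
  forall w : 'I_4 -> R, exists (c : R) (x : 'cV[R]_3),
    forall i, c * al i + (x^T *m be i) 0 0 = w i.
Proof.
move=> inj w.
pose M : 'M[R]_(1 + 3, 4) := col_mx (\row_i al i) (\matrix_(k, i) be i k 0).
have E (c : R) (x : 'cV[R]_3) i :
    (row_mx c%:M x^T *m M) 0 i = c * al i + (x^T *m be i) 0 0.
  rewrite mul_row_col mxE mul_scalar_mx !mxE; congr (_ + _).
  by apply: eq_bigr => k _; rewrite !mxE.
have decomp (z : 'rV[R]_(1 + 3)) : z = row_mx (lsubmx z 0 0)%:M ((rsubmx z)^T)^T.
  by rewrite trmxK -mx11_scalar hsubmxK.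
have uM : (M : 'M[R]_4) \in unitmx.
  rewrite -row_free_unit; apply: inj_row_free => z' zM; pose z : 'rV[R]_(1 + 3) := z'.
  have [|z1 z2] := inj (lsubmx z 0 0) (rsubmx z)^T.
    by move=> i; rewrite -E -decomp zM mxE.
  by rewrite -/z (decomp z) z1 z2 trmx0 raddf0 row_mx0.
pose z : 'rV[R]_(1 + 3) := (\row_i w i) *m invmx M.
exists (lsubmx z 0 0), ((rsubmx z)^T) => i.
by rewrite -E -decomp /z mulmxKV // mxE.
Qed.

Lemma face_area_gt0 (R : realType) (p N : 'I_4 -> 'cV[R]_3) (i : 'I_4) :
  is_bary_grad p N ->
  0 < area_factor (p (lift i 1) - p (lift i 0)) (p (lift i 2%:R) - p (lift i 0)).
Proof.
move=> [_ _ hN]; apply: (@area_factor_gt0 _ _ _ (N (lift i 2%:R))).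
- by rewrite hN !(inj_eq lift_inj) subrr.
- by rewrite hN !(inj_eq lift_inj) eqxx subr0.
apply/eqP => e; have := hN (lift i 1) (lift i 1) (lift i 0).
rewrite e dotv0r eqxx (inj_eq lift_inj) subr0 => /eqP.
by rewrite eq_sym oner_eq0.
Qed.

Theorem lemma3p1 (R : realType) (p nu : 'I_4 -> 'cV[R]_3)
    (g : 'cV[R]_3) (b : R) (T : 'M[R]_3) (alphap alpham : R) (xK : 'cV[R]_3)
    (hp : nondegenerate_tetra p)
    (hnu : unit_face_normals p nu)
    (hshape : trirectangular_tetra nu \/ regular_tetra p)
    (hK : interface_element p (affine_fun g b))
    (hT : interface_frame g T)
    (hap : 0 < alphap) (ham : 0 < alpham)
    (hxK : interface_piece p (affine_fun g b) xK)
    (w : 'I_4 -> R) :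
  exists! v : 'cV[R]_3 -> 'cV[R]_3,
    Sfh p (affine_fun g b) (AK T alphap alpham) xK v /\
    forall i : 'I_4, face_flux p nu v i = w i.
Proof.
have [N hN] := bary_grad_exists hp.
have [mu hmu] : exists mu, frame_weights N mu.
  case: hshape => h; first exact (frame_weights_trirectangular hN hnu h).
  exact (frame_weights_regular hN h).
have [sg hs] := normal_bary_grad hN hnu.
have [TT [s ng]] := hT.
have nn : dotv (col 0 T) (col 0 T) = 1.
  transitivity ((T^T *m T) 0 0); last by rewrite TT mxE eqxx.
  by rewrite dotvE [RHS]mxE; apply: eq_bigr => k _; rewrite !mxE.
have [D [e thE]] := face_nonpos_area_affine (interface_not_constant hK).
set th := face_nonpos_area _ in thE.
have thb i : 0 <= th i <= ref_area R.
  by rewrite /th /face_nonpos_area; exact: nonpos_area_bounds.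
set A := AK T alphap alpham.
pose G (i : 'I_4) :=
  area_factor (p (lift i 1) - p (lift i 0)) (p (lift i 2%:R) - p (lift i 0)).
pose al (i : 'I_4) := G i * (dotv (p (lift i 0) - xK) (nu i) * ref_area R).
pose be i := G i *: (ref_area R *: nu i + th i *: (A^T *m nu i - nu i)).
have fluxE (c : R) (cp : 'cV[R]_3) i :
    face_flux p nu (interface_field p (affine_fun g b) A xK c cp) i =
    c * al i + (cp^T *m be i) 0 0.
  rewrite face_flux_interface_field // -/th -/(G i) /al -/(dotv cp (be i)) /be.
  rewrite dotvZr dotvDr !dotvZr dotvBr (dotvBl _ (A *m cp)).
  have -> : dotv (A *m cp) (nu i) = dotv cp (A^T *m nu i).
    by rewrite /dotv trmx_mul mulmxA.
  by ring.
have inj (c : R) (cp : 'cV[R]_3) :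
    (forall i, c * al i + (cp^T *m be i) 0 0 = 0) -> c = 0 /\ cp = 0.
  move=> h; have rho0 : 0 < alphap / alpham by rewrite divr_gt0.
  have K := zero_flux_eq0 (c := c) (cp := cp) hN hmu hxK.1 ng nn rho0
    (ref_area_gt0 R) thb thE.
  apply: K => i.
  have := h i; rewrite -fluxE face_flux_interface_field // -/th -/(G i).
  have [s0 nuE] := hs i.
  move/eqP; rewrite mulf_eq0 (gt_eqF (face_area_gt0 i hN)) /= => /eqP.
  have -> : A *m cp - cp =
    (alphap / alpham - 1) *: (cp - dotv (col 0 T) cp *: col 0 T).
    rewrite /A AK_mulE //; apply/matrixP => k l; rewrite !mxE; ring.
  rewrite nuE !dotvZr => h'; apply: (mulfI s0); rewrite mulr0 -h'; ring.
have [c [cp hc]] := linear_system_solvable inj w.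
exists (interface_field p (affine_fun g b) A xK c cp); split.
  by split=> [|i]; [apply/SfhP; exists c, cp|rewrite fluxE].
move=> _ [/SfhP[c' [cp' ->]] hw].
have [|dc dcp] := inj (c - c') (cp - cp'); last first.
  by rewrite (subr0_eq dc) (subr0_eq dcp).
move=> i; rewrite -/(dotv (cp - cp') (be i)) dotvBl mulrBl addrACA -opprD.
by apply/eqP; rewrite subr_eq0 hc -(hw i) fluxE.
Qed.
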